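(* Let $M\ge 0$ be a real number and let $f(z)=h(z)+\overline{g(z)}$ be a harmonic mapping of the unit disk $U$, where $h(z)=\sum_{n=0}^{\infty}a_nz^n$ and $g(z)=\sum_{n=1}^{\infty}b_nz^n$ are analytic in $U$. If $|f(z)|\le M$ for all $z\in U$, then $$|a_n|+|b_n|\le \frac{4}{\pi}M\qquad\text{for all } n=1,2,\dots.$$ These inequalities are sharp for all $n=1,2,\dots$; that is, for each $n\ge 1$ there is a harmonic mapping $f(z)=h(z)+\overline{g(z)}$ of $U$, where $h(z)=\sum_{k=0}^{\infty}a_kz^k$ and $g(z)=\sum_{k=1}^{\infty}b_kz^k$ are analytic in $U$, with $|f(z)|\le M$ on $U$ for which $|a_n|+|b_n|=\frac{4}{\pi}M$.
   Context: $U=\{z\in\mathbb{C}:|z|<1\}$ is the open unit disk. A harmonic mapping is a complex-valued harmonic function (not assumed injective). *)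

(* Defs.v *)
From Stdlib Require Import Reals.
From Coquelicot Require Import Coquelicot.

(* Functions are total on [C]; every notion below only constrains them on the
   open unit disk. *)
Definition in_disk (z : C) : Prop := (Cmod z < 1)%R.

(* [ex_diff_n u 2 x y]: the partial derivatives of [u] up to order 2 exist at
   (x, y) and are continuous there.  Quantified over the (open) disk, this says
   that [u] is of class C^2 on the disk. *)
Definition real_harmonic_on_disk (u : R -> R -> R) : Prop :=
  forall x y : R, in_disk (x, y) ->
    ex_diff_n u 2 x y /\
    (partial_derive 2 0 u x y + partial_derive 0 2 u x y = 0)%R.

Definition harmonic_mapping (f : C -> C) : Prop :=
  real_harmonic_on_disk (fun x y => Re (f (x, y))) /\
  real_harmonic_on_disk (fun x y => Im (f (x, y))).

Definition analytic_on_disk (h : C -> C) : Prop :=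
  forall z : C, in_disk z ->
    @ex_derive C_AbsRing C_NormedModule h z.

Definition power_series_on_disk (h : C -> C) (a : nat -> C) : Prop :=
  forall z : C, in_disk z ->
    @is_pseries C_AbsRing C_NormedModule a z (h z).

(* The series of [g] starts at index 1, i.e. [b 0 = 0]. *)
Definition canonical_representation
    (f h g : C -> C) (a b : nat -> C) : Prop :=
  (forall z : C, in_disk z -> f z = Cplus (h z) (Cconj (g z))) /\
  analytic_on_disk h /\ power_series_on_disk h a /\
  analytic_on_disk g /\ power_series_on_disk g b /\ b 0%nat = RtoC 0.

(* Main.v *)
Require Import Defs.
From Stdlib Require Import Reals Lra Lia.
From Coquelicot Require Import Coquelicot.
Local Open Scope R_scope.

(** The bound.  Choose a unimodular number u that turns the two coefficients
    into the same direction, so that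
    |u * a n + conj u * b n| = |a n| + |b n|.  The function
    H = u * h + conj u * g is analytic with Taylor coefficients
    c k = u * a k + conj u * b k, and Re H = Re (u * f); hence
    |Re H| <= M.  It remains to bound a Taylor coefficient of an analytic
    function with bounded real part ([bounded_re_coef_le]).  Write
    c n = |c n| e^(i theta).  By orthogonality of the trigonometric functions,
    over one period
      int Re H(r e^(i t)) cos (n t + theta) dt = PI * r^n * |c n|,
    whereas int |cos (n t + theta)| dt = 4.  So PI * r^n * |c n| <= 4 * M, and
    r tends to 1.  The integral is taken of the partial sums of H, which are
    uniformly close to H on each circle; no integrability of H itself has to
    be discussed.

    Sharpness.  Equality calls for boundary values of Re H equal to M times
    the sign of cos (n t + theta).  The Poisson extension of such a square
    wave is, after a rotation, (4 M / PI) Im (artanh (z^n)), where artanh w is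
    the sum of w^k / k over odd k.  It is bounded by M because Im (artanh w)
    is half the argument of (1 + w) / (1 - w), a point of the right half
    plane: it equals atan (2 Im w / (1 - |w|^2)) / 2 ([Im_artanh]).  This
    identity is obtained by differentiating both sides along the segment from
    0 to w.

    Both the harmonicity of f and the differentiation along segments rest on
    termwise differentiation of complex power series, in the quantitative form
    |h z' - h z - (z' - z) h' z| <= K |z' - z|^2 on each smaller disk
    ([power_series_taylor]): complex derivatives, real directional derivatives
    and continuity all follow from this one inequality. *)

(** * Complex power series on the unit disk *)

Notation is_cseries := (@is_series C_AbsRing C_NormedModule).

Lemma is_series_norm_le {K : AbsRing} {V : NormedModule K}
    (u : nat -> V) (v : nat -> R) (l : V) (L : R) :
  (forall k, norm (u k) <= v k) -> is_series u l -> is_series v L ->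
  norm l <= L.
Proof.
  intros Huv Hu Hv.
  apply (is_lim_seq_le (fun n => norm (sum_n u n)) (sum_n v) (norm l) L).
  - intros n. eapply Rle_trans; [apply norm_sum_n_m|].
    now apply sum_n_m_le.
  - exact (filterlim_comp _ _ _ _ _ _ _ _ Hu (filterlim_norm l)).
  - exact Hv.
Qed.

(** Convergence in [C] is convergence in the product R * R, so it passes to
    the coordinates. *)
Lemma is_cseries_re (u : nat -> C) (l : C) :
  is_cseries u l -> is_series (fun k => Re (u k)) (Re l).
Proof.
  intros Hu.
  assert (E : forall n, sum_n (fun k => Re (u k)) n
                        = Re (@sum_n C_AbsRing u n)).
  { intros n; induction n as [|n IH].
    - now rewrite !sum_O.
    - now rewrite !sum_Sn, IH. }
  apply filterlim_ext with (fun n => Re (@sum_n C_AbsRing u n)).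
  { intros n; symmetry; apply E. }
  apply filterlim_locally; intros eps.
  generalize (proj1 (filterlim_locally _ _) Hu eps).
  apply filter_imp; intros n [H _]; exact H.
Qed.

Lemma is_cseries_im (u : nat -> C) (l : C) :
  is_cseries u l -> is_series (fun k => Im (u k)) (Im l).
Proof.
  intros Hu.
  assert (E : forall n, sum_n (fun k => Im (u k)) n
                        = Im (@sum_n C_AbsRing u n)).
  { intros n; induction n as [|n IH].
    - now rewrite !sum_O.
    - now rewrite !sum_Sn, IH. }
  apply filterlim_ext with (fun n => Im (@sum_n C_AbsRing u n)).
  { intros n; symmetry; apply E. }
  apply filterlim_locally; intros eps.
  generalize (proj1 (filterlim_locally _ _) Hu eps).
  apply filter_imp; intros n [_ H]; exact H.
Qed.

(** The value is total: it means the sum of the series only when the real and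
    the imaginary parts both converge. *)
Definition CSeries (u : nat -> C) : C :=
  (Series (fun k => Re (u k)), Series (fun k => Im (u k))).

Lemma CSeries_unique (u : nat -> C) (l : C) : is_cseries u l -> CSeries u = l.
Proof.
  intros Hl. unfold CSeries.
  rewrite (is_series_unique _ _ (is_cseries_re _ _ Hl)).
  rewrite (is_series_unique _ _ (is_cseries_im _ _ Hl)).
  symmetry; apply surjective_pairing.
Qed.

Lemma CSeries_correct (u : nat -> C) (v : nat -> R) :
  (forall k, Cmod (u k) <= v k) -> ex_series v -> is_cseries u (CSeries u).
Proof.
  intros Huv Hv.
  destruct (@ex_series_le C_AbsRing C_CompleteNormedModule u v Huv Hv)
    as [l Hl].
  now rewrite (CSeries_unique u l Hl).
Qed.

Lemma pow_n_Cpow (z : C) (k : nat) : @pow_n C_Ring z k = (z ^ k)%C.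
Proof. induction k as [|k IH]; [reflexivity|]; simpl; now rewrite IH. Qed.

Lemma is_pseries_C (a : nat -> C) (z l : C) :
  @is_pseries C_AbsRing C_NormedModule a z l
  <-> is_cseries (fun k => a k * z ^ k)%C l.
Proof.
  split; apply is_series_ext; intros k;
    change (scal (pow_n z k) (a k)) with (@pow_n C_Ring z k * a k)%C;
    rewrite (pow_n_Cpow z k); apply Cmult_comm.
Qed.

Lemma Cmod_le_Re_Im (w : C) : Cmod w <= Rabs (Re w) + Rabs (Im w).
Proof.
  replace w with (RtoC (Re w) + Ci * RtoC (Im w))%C at 1
    by (destruct w as [x y]; unfold Re, Im, Ci, RtoC, Cplus, Cmult; simpl; f_equal; ring).
  eapply Rle_trans; [apply Cmod_triangle|].
  rewrite Cmod_mult, Cmod_Ci, !Cmod_R. lra.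
Qed.

(** The terms of a series that converges at a real point r < 1 tend to zero,
    which excludes a radius of convergence below r.  This gives access to the
    theory of real power series, applied to the moduli of the coefficients. *)
Lemma power_series_CV_radius (h : C -> C) (a : nat -> C) :
  power_series_on_disk h a ->
  Rbar_le 1 (CV_radius (fun k => Cmod (a k))).
Proof.
  intros Ha.
  assert (H : forall r, 0 < r < 1 ->
            Rbar_le r (CV_radius (fun k => Cmod (a k)))).
  { intros r Hr. apply Rbar_not_lt_le; intros Hlt.
    apply (CV_disk_outside (fun k => Cmod (a k)) r).
    - rewrite Rabs_pos_eq by lra; exact Hlt.
    - assert (Hz : in_disk (RtoC r)).
      { unfold in_disk; rewrite Cmod_R, Rabs_pos_eq; lra. }
      assert (Hs := proj1 (is_pseries_C _ _ _) (Ha _ Hz)).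
      assert (Hre := ex_series_lim_0 _ (ex_intro _ _ (is_cseries_re _ _ Hs))).
      assert (Him := ex_series_lim_0 _ (ex_intro _ _ (is_cseries_im _ _ Hs))).
      apply is_lim_seq_le_le with (u := fun _ => 0)
        (w := fun k => Rabs (Re (a k * RtoC r ^ k)%C)
                       + Rabs (Im (a k * RtoC r ^ k)%C)).
      + intros k. rewrite <- (Rabs_pos_eq r) at 1 2 by lra.
        rewrite <- Cmod_R, <- Cmod_pow, <- Cmod_mult. split.
        * apply Cmod_ge_0.
        * apply Cmod_le_Re_Im.
      + apply is_lim_seq_const.
      + replace (Finite 0) with (Finite (Rabs 0 + Rabs 0))
          by (rewrite Rabs_R0; f_equal; ring).
        apply is_lim_seq_plus'; apply (is_lim_seq_abs _ (Finite 0)); assumption. }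
  destruct (CV_radius (fun k => Cmod (a k))) as [R0| |]; simpl in *.
  - apply Rnot_lt_le; intros Hlt.
    assert (H0 := H (1/2) ltac:(lra)).
    assert (H1 := H ((1 + R0) / 2) ltac:(lra)). lra.
  - exact I.
  - exact (H (1/2) ltac:(lra)).
Qed.

Lemma ex_series_abs_coef (a : nat -> C) (r : R) :
  Rbar_le 1 (CV_radius (fun k => Cmod (a k))) -> 0 <= r < 1 ->
  ex_series (fun k => Cmod (a k) * r ^ k).
Proof.
  intros Ha Hr.
  apply ex_series_ext with (fun k => Rabs (Cmod (a k) * r ^ k)).
  - intros k; apply Rabs_pos_eq, Rmult_le_pos;
      [apply Cmod_ge_0 | apply pow_le; lra].
  - apply (CV_disk_inside (fun k => Cmod (a k))).
    rewrite Rabs_pos_eq by lra.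
    apply Rbar_lt_le_trans with (2 := Ha). simpl; lra.
Qed.

Definition CPSeries (a : nat -> C) (z : C) : C :=
  CSeries (fun k => a k * z ^ k)%C.

Lemma CPSeries_correct (a : nat -> C) :
  Rbar_le 1 (CV_radius (fun k => Cmod (a k))) ->
  power_series_on_disk (CPSeries a) a.
Proof.
  intros Ha z Hz. apply is_pseries_C.
  apply CSeries_correct with (fun k => Cmod (a k) * Cmod z ^ k).
  - intros k. rewrite Cmod_mult, Cmod_pow; lra.
  - apply ex_series_abs_coef; [exact Ha|].
    split; [apply Cmod_ge_0 | exact Hz].
Qed.

Lemma power_series_scal (h : C -> C) (a : nat -> C) (u : C) :
  power_series_on_disk h a ->
  power_series_on_disk (fun z => u * h z)%C (fun k => u * a k)%C.
Proof.
  intros Ha z Hz. apply is_pseries_C.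
  refine (is_series_ext _ _ _ _
    (is_series_scal_l u _ _ (proj1 (is_pseries_C _ _ _) (Ha z Hz)))).
  intros k. apply Cmult_assoc.
Qed.

Lemma power_series_plus (h g : C -> C) (a b : nat -> C) :
  power_series_on_disk h a -> power_series_on_disk g b ->
  power_series_on_disk (fun z => h z + g z)%C (fun k => a k + b k)%C.
Proof.
  intros Ha Hb z Hz. apply is_pseries_C.
  refine (is_series_ext _ _ _ _ (is_series_plus _ _ _ _
    (proj1 (is_pseries_C _ _ _) (Ha z Hz))
    (proj1 (is_pseries_C _ _ _) (Hb z Hz)))).
  intros k. symmetry. apply Cmult_plus_distr_r.
Qed.

Lemma power_series_lincomb (h g : C -> C) (a b : nat -> C) (u v : C) :
  power_series_on_disk h a -> power_series_on_disk g b ->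
  power_series_on_disk (fun z => u * h z + v * g z)%C
                       (fun k => u * a k + v * b k)%C.
Proof.
  intros Ha Hb. apply power_series_plus; now apply power_series_scal.
Qed.

Lemma power_series_at_0 (h : C -> C) (a : nat -> C) :
  power_series_on_disk h a -> h 0 = a 0%nat.
Proof.
  intros Ha.
  assert (H0 : in_disk 0) by (unfold in_disk; rewrite Cmod_0; lra).
  assert (H1 := proj1 (is_pseries_C a 0 (h 0)) (Ha 0 H0)).
  assert (H2 := proj1 (is_pseries_C a 0 (a 0%nat))
                  (is_pseries_0 (K := C_AbsRing) (V := C_NormedModule) a)).
  now rewrite <- (CSeries_unique _ _ H1), (CSeries_unique _ _ H2).
Qed.

(** * Termwise differentiation *)

Definition CPS_derive (a : nat -> C) (k : nat) : C :=
  (RtoC (INR (S k)) * a (S k))%C.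

Lemma Cmod_CPS_derive (a : nat -> C) (k : nat) :
  Cmod (CPS_derive a k) = PS_derive (fun k => Cmod (a k)) k.
Proof.
  unfold CPS_derive, PS_derive.
  now rewrite Cmod_mult, Cmod_R, Rabs_pos_eq by apply pos_INR.
Qed.

(** Differentiation multiplies the moduli of the coefficients in the same way
    as for real series, and there it keeps the radius of convergence. *)
Lemma power_series_derive (h : C -> C) (a : nat -> C) :
  power_series_on_disk h a ->
  power_series_on_disk (CPSeries (CPS_derive a)) (CPS_derive a).
Proof.
  intros Ha. apply CPSeries_correct.
  rewrite (CV_radius_ext _ _ (Cmod_CPS_derive a)), CV_radius_derive.
  exact (power_series_CV_radius h a Ha).
Qed.

(** The remainder D (k + 1) of the first order expansion of z'^(k + 1)
    satisfies D (k + 1) = z' * D k + k * z^(k - 1) * (z' - z)^2, and the bound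
    follows by induction.  The exponents start at 2 so that no truncated
    subtraction appears. *)
Lemma Cpow_taylor_bound (z z' : C) (rho : R) (k : nat) :
  Cmod z <= rho -> Cmod z' <= rho ->
  Cmod (z' ^ S (S k) - z ^ S (S k)
        - (z' - z) * (RtoC (INR (S (S k))) * z ^ S k))%C
  <= INR (S (S k)) * INR (S k) * rho ^ k * Cmod (z' - z)%C ^ 2.
Proof.
  intros Hz Hz'.
  assert (Hrho : 0 <= rho) by (generalize (Cmod_ge_0 z); lra).
  assert (He := Cmod_ge_0 (z' - z)%C).
  induction k as [|k IH].
  - replace (z' ^ 2 - z ^ 2 - (z' - z) * (RtoC (INR 2) * z ^ 1))%C
      with ((z' - z) ^ 2)%C by (simpl; rewrite RtoC_plus; ring).
    rewrite Cmod_pow; simpl.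
    generalize (pow2_ge_0 (Cmod (z' - z))); simpl; lra.
  - set (D := (z' ^ S (S k) - z ^ S (S k)
        - (z' - z) * (RtoC (INR (S (S k))) * z ^ S k))%C) in *.
    replace (z' ^ S (S (S k)) - z ^ S (S (S k))
        - (z' - z) * (RtoC (INR (S (S (S k)))) * z ^ S (S k)))%C
      with (z' * D + RtoC (INR (S (S k))) * z ^ S k * (z' - z) ^ 2)%C.
    2:{ unfold D. rewrite (S_INR (S (S k))), RtoC_plus, !Cpow_S.
        change (z ^ 0)%C with (RtoC 1). simpl. ring. }
    eapply Rle_trans; [apply Cmod_triangle|].
    rewrite !Cmod_mult, !Cmod_pow, Cmod_R, Rabs_pos_eq by apply pos_INR.
    assert (H1 : Cmod z' * Cmod D <=
       rho * (INR (S (S k)) * INR (S k) * rho ^ k * Cmod (z' - z)%C ^ 2)).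
    { apply Rmult_le_compat; auto using Cmod_ge_0. }
    assert (H2 : INR (S (S k)) * Cmod z ^ S k * Cmod (z' - z)%C ^ 2 <=
       INR (S (S k)) * rho ^ S k * Cmod (z' - z)%C ^ 2).
    { apply Rmult_le_compat_r; [apply pow2_ge_0|].
      apply Rmult_le_compat_l; [apply pos_INR|].
      apply pow_incr; auto using Cmod_ge_0. }
    assert (H3 : 0 <= INR (S (S k)) * rho ^ S k * Cmod (z' - z)%C ^ 2).
    { apply Rmult_le_pos; [|apply pow2_ge_0].
      apply Rmult_le_pos; [apply pos_INR | now apply pow_le]. }
    rewrite (S_INR (S (S k))).
    replace ((INR (S (S k)) + 1) * INR (S (S k)) * rho ^ S k * Cmod (z' - z)%C ^ 2)
      with (rho * (INR (S (S k)) * INR (S k) * rho ^ k * Cmod (z' - z)%C ^ 2)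
            + 2 * (INR (S (S k)) * rho ^ S k * Cmod (z' - z)%C ^ 2)).
    2:{ rewrite (S_INR (S k)); simpl (rho ^ S k); ring. }
    lra.
Qed.

(** After the factor |z' - z|^2 is taken out, the bound for the terms of degree
    k + 2 is (k + 2) (k + 1) rho^k |a (k + 2)|.  This is the modulus of the
    general term at rho of the twice differentiated series, hence summable. *)
Lemma power_series_taylor (h h' : C -> C) (a : nat -> C) (rho : R) :
  power_series_on_disk h a -> power_series_on_disk h' (CPS_derive a) ->
  0 <= rho < 1 ->
  exists K, 0 <= K /\ forall z z', Cmod z <= rho -> Cmod z' <= rho ->
    Cmod (h z' - h z - (z' - z) * h' z)%C <= K * Cmod (z' - z)%C ^ 2.
Proof.
  intros Ha Ha' Hrho.
  set (A := fun k => Cmod (a k)).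
  set (A2 := fun k => INR (S (S k)) * INR (S k) * A (S (S k)) * rho ^ k).
  assert (HA2 : exists K : R, is_series A2 K).
  { change (ex_series A2). apply ex_series_ext
      with (fun k => Cmod (CPS_derive (CPS_derive a) k) * rho ^ k).
    - intros k. unfold CPS_derive, A2, A.
      rewrite !Cmod_mult, !Cmod_R, !Rabs_pos_eq by apply pos_INR.
      match goal with |- ?l = ?r => change (l = r :> R) end. ring.
    - apply ex_series_abs_coef; [|exact Hrho].
      exact (power_series_CV_radius _ _ (power_series_derive _ _ Ha')). }
  set (V := fun k => match k with S (S k) => A2 k | _ => 0 end).
  destruct HA2 as [K HK].
  (* shifting [A2] by two makes its index agree with that of the terms of h *)
  assert (HV : is_series V K).
  { apply is_series_decr_1, is_series_decr_1.
    replace (plus _ _) with K; [exact HK|].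
    change (@eq R K ((K + - 0) + - 0)). ring. }
  exists K. split.
  { change K with (real (Finite K)).
    apply (is_lim_seq_le (fun _ => 0) (sum_n V) 0 K);
      [|apply is_lim_seq_const|exact HV].
    intros n. rewrite <- (Rmult_0_r (INR (S n))), <- (sum_n_const n 0).
    apply sum_n_m_le. intros [|[|k]]; simpl; try lra.
    unfold A2, A. apply Rmult_le_pos; [|apply pow_le; lra].
    apply Rmult_le_pos; [|apply Cmod_ge_0].
    apply Rmult_le_pos; apply pos_INR. }
  intros z z' Hz Hz'.
  assert (Dz : in_disk z) by (unfold in_disk; lra).
  assert (Dz' : in_disk z') by (unfold in_disk; lra).
  assert (S1 := proj1 (is_pseries_C _ _ _) (Ha _ Dz')).
  assert (S2 := proj1 (is_pseries_C _ _ _) (Ha _ Dz)).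
  assert (S3 := proj1 (is_pseries_C _ _ _) (Ha' _ Dz)).
  (* the derived series, with its term in z^(k-1) placed at index k *)
  set (w := fun k => match k with 0%nat => RtoC 0
                     | S k => (CPS_derive a k * z ^ k)%C end).
  assert (S4 : is_cseries w (h' z)).
  { apply is_series_decr_1.
    replace (plus _ _) with (h' z); [exact S3|].
    change (@eq C (h' z) (h' z + - RtoC 0)%C). ring. }
  assert (S5 := is_series_minus _ _ _ _ (is_series_minus _ _ _ _ S1 S2)
                  (is_series_scal_l (z' - z)%C _ _ S4)).
  assert (S6 := is_series_scal_l (Cmod (z' - z)%C ^ 2) _ _ HV).
  rewrite Rmult_comm.
  refine (is_series_norm_le _ _ _ _ _ S5 S6).
  assert (He := pow2_ge_0 (Cmod (z' - z)%C)).
  intros k.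
  change (Cmod (a k * z' ^ k + - (a k * z ^ k) + - ((z' - z) * w k))%C
          <= Cmod (z' - z)%C ^ 2 * V k).
  destruct k as [|[|k]]; simpl w; simpl V.
  - replace (_ + - _)%C with (RtoC 0) by (simpl; ring).
    rewrite Cmod_0; lra.
  - replace (_ + - _)%C with (RtoC 0) by (unfold CPS_derive; simpl; ring).
    rewrite Cmod_0; lra.
  - replace (_ + - _)%C with
      (a (S (S k)) * (z' ^ S (S k) - z ^ S (S k)
        - (z' - z) * (RtoC (INR (S (S k))) * z ^ S k)))%C
      by (unfold CPS_derive; rewrite !Cpow_S; ring).
    rewrite Cmod_mult.
    apply Rle_trans with (Cmod (a (S (S k))) *
      (INR (S (S k)) * INR (S k) * rho ^ k * Cmod (z' - z)%C ^ 2)).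
    + apply Rmult_le_compat_l; [apply Cmod_ge_0|].
      now apply Cpow_taylor_bound.
    + unfold A2, A. simpl. lra.
Qed.

Lemma is_derive_of_quadratic_bound {K : AbsRing} {V : NormedModule K}
    (f : K -> V) (x : K) (l : V) (B : R) :
  0 <= B ->
  locally x (fun y => norm (minus (minus (f y) (f x)) (scal (minus y x) l))
                      <= B * abs (minus y x) ^ 2) ->
  is_derive f x l.
Proof.
  intros HB Hloc. split; [apply is_linear_scal_l|].
  intros x' Hx'.
  rewrite <- (is_filter_lim_locally_unique x x' Hx') in *; clear x' Hx'.
  intros eps.
  assert (Hd : 0 < eps / (B + 1)).
  { apply Rdiv_lt_0_compat; [apply cond_pos | lra]. }
  assert (Hnear : locally x (fun y => abs (minus y x) < eps / (B + 1))).
  { exists (mkposreal _ Hd). intros y Hy; exact Hy. }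
  generalize (filter_and _ _ Hloc Hnear). apply filter_imp.
  intros y [H1 H2]. eapply Rle_trans; [exact H1|].
  change (norm (minus y x)) with (abs (minus y x)).
  assert (H0 := abs_ge_0 (minus y x)).
  replace (abs (minus y x) ^ 2) with (abs (minus y x) * abs (minus y x)) by ring.
  rewrite <- Rmult_assoc. apply Rmult_le_compat_r; [exact H0|].
  apply Rle_trans with (B * (eps / (B + 1))).
  - apply Rmult_le_compat_l; lra.
  - apply Rmult_le_reg_r with (B + 1); [lra|].
    replace (B * (eps / (B + 1)) * (B + 1)) with (B * eps) by (field; lra).
    generalize (cond_pos eps); lra.
Qed.

Lemma power_series_taylor_at (h h' : C -> C) (a : nat -> C)
    (Ha : power_series_on_disk h a)
    (Ha' : power_series_on_disk h' (CPS_derive a))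
    (p : C) : in_disk p ->
  exists B d, 0 <= B /\ 0 < d /\ forall q, Cmod (q - p)%C < d ->
    in_disk q /\
    Cmod (h q - h p - (q - p) * h' p)%C <= B * Cmod (q - p)%C ^ 2.
Proof.
  intros Hp. unfold in_disk in *.
  assert (H0 := Cmod_ge_0 p).
  destruct (power_series_taylor h h' a ((1 + Cmod p) / 2) Ha Ha')
    as [B [HB HT]]; [lra|].
  exists B, ((1 - Cmod p) / 2). split; [exact HB|]. split; [lra|].
  intros q Hq.
  assert (Hq' : Cmod q <= Cmod p + Cmod (q - p)%C).
  { replace q with (p + (q - p))%C at 1 by ring. apply Cmod_triangle. }
  split; [lra|]. apply HT; lra.
Qed.

Lemma power_series_is_derive (h h' : C -> C) (a : nat -> C)
    (Ha : power_series_on_disk h a)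
    (Ha' : power_series_on_disk h' (CPS_derive a))
    (p : C) : in_disk p ->
  @is_derive C_AbsRing C_NormedModule h p (h' p).
Proof.
  intros Hp. destruct (power_series_taylor_at h h' a Ha Ha' p Hp) as (B & d & HB & Hd & HT).
  apply is_derive_of_quadratic_bound with B; [exact HB|].
  exists (mkposreal d Hd). intros q Hq. exact (proj2 (HT q Hq)).
Qed.

(** Real differentiation needs only the complex derivative in one direction v.
    Particular choices of c and v give the partial derivatives of Re h and
    Im h, and the derivative along a ray. *)
Lemma power_series_is_derive_line (h h' : C -> C) (a : nat -> C)
    (Ha : power_series_on_disk h a)
    (Ha' : power_series_on_disk h' (CPS_derive a))
    (c z v : C) (t : R) :
  in_disk (z + RtoC t * v)%C ->
  is_derive (fun s => Re (c * h (z + RtoC s * v))%C) t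
            (Re (c * v * h' (z + RtoC t * v))%C).
Proof.
  intros Hp. set (p := (z + RtoC t * v)%C) in *.
  destruct (power_series_taylor_at h h' a Ha Ha' p Hp) as (B & d & HB & Hd & HT).
  assert (Hv := Cmod_ge_0 v). assert (Hc := Cmod_ge_0 c).
  apply is_derive_of_quadratic_bound with (Cmod c * (B * Cmod v ^ 2)).
  { apply Rmult_le_pos; [exact Hc|]. apply Rmult_le_pos; [exact HB|].
    apply pow2_ge_0. }
  assert (Hd' : 0 < d / (Cmod v + 1)) by (apply Rdiv_lt_0_compat; lra).
  exists (mkposreal _ Hd'). intros s Hs.
  change (Rabs (s - t) < d / (Cmod v + 1)) in Hs.
  set (q := (z + RtoC s * v)%C).
  assert (Eqp : (q - p)%C = (RtoC (s - t) * v)%C).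
  { unfold q, p. rewrite RtoC_minus. ring. }
  assert (Mqp : Cmod (q - p)%C = Rabs (s - t) * Cmod v).
  { rewrite Eqp, Cmod_mult, Cmod_R. reflexivity. }
  assert (Hq : Cmod (q - p)%C < d).
  { rewrite Mqp. apply Rle_lt_trans with (Rabs (s - t) * (Cmod v + 1)).
    - apply Rmult_le_compat_l; [apply Rabs_pos | lra].
    - replace d with (d / (Cmod v + 1) * (Cmod v + 1)) by (field; lra).
      apply Rmult_lt_compat_r; lra. }
  change (Rabs (Re (c * h q)%C - Re (c * h p)%C
                - (s - t) * Re (c * v * h' p)%C)
          <= Cmod c * (B * Cmod v ^ 2) * Rabs (s - t) ^ 2).
  replace (Re (c * h q)%C - Re (c * h p)%C - (s - t) * Re (c * v * h' p)%C)
    with (Re (c * (h q - h p - (q - p) * h' p))%C).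
  2:{ rewrite Eqp. unfold Re, Cmult, Cminus, Cplus, Copp, RtoC; simpl. ring. }
  eapply Rle_trans; [apply re_le_Cmod|].
  rewrite Cmod_mult, Rmult_assoc. apply Rmult_le_compat_l; [exact Hc|].
  eapply Rle_trans; [exact (proj2 (HT q Hq))|].
  rewrite Mqp. apply Req_le. ring.
Qed.

Lemma power_series_continuity_2d (h h' : C -> C) (a : nat -> C)
    (Ha : power_series_on_disk h a)
    (Ha' : power_series_on_disk h' (CPS_derive a))
    (c : C) (x y : R) : in_disk (x, y) ->
  continuity_2d_pt (fun x y => Re (c * h (x, y))%C) x y.
Proof.
  intros Hp eps. set (p := (x, y) : C) in *.
  destruct (power_series_taylor_at h h' a Ha Ha' p Hp) as (B & d & HB & Hd & HT).
  set (L := Cmod c * (B * d + Cmod (h' p))).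
  assert (HL : 0 <= L).
  { apply Rmult_le_pos; [apply Cmod_ge_0|].
    generalize (Rmult_le_pos B d HB (Rlt_le _ _ Hd)) (Cmod_ge_0 (h' p)); lra. }
  assert (He := cond_pos eps).
  assert (Hr : 0 < Rmin d (eps / (L + 1)) / 2).
  { apply Rdiv_lt_0_compat; [|lra].
    apply Rmin_glb_lt; [exact Hd|]. apply Rdiv_lt_0_compat; lra. }
  exists (mkposreal _ Hr). intros u v Hu Hv. simpl in Hu, Hv. set (q := (u, v) : C).
  assert (Hq : Cmod (q - p)%C < Rmin d (eps / (L + 1))).
  { eapply Rle_lt_trans; [apply Cmod_le_Re_Im|].
    change (Rabs (u - x) + Rabs (v - y) < Rmin d (eps / (L + 1))). lra. }
  assert (Hq1 := Rlt_le_trans _ _ _ Hq (Rmin_l _ _)).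
  assert (Hq2 := Rlt_le_trans _ _ _ Hq (Rmin_r _ _)).
  assert (H0 := Cmod_ge_0 (q - p)%C).
  replace (Re (c * h q)%C - Re (c * h p)%C)
    with (Re (c * ((h q - h p - (q - p) * h' p) + (q - p) * h' p))%C)
    by (unfold Re, Cmult, Cminus, Cplus, Copp; simpl; ring).
  apply Rle_lt_trans with (L * Cmod (q - p)%C).
  - eapply Rle_trans; [apply re_le_Cmod|].
    rewrite Cmod_mult. unfold L. rewrite Rmult_assoc.
    apply Rmult_le_compat_l; [apply Cmod_ge_0|].
    eapply Rle_trans; [apply Cmod_triangle|].
    rewrite Cmod_mult, Rmult_plus_distr_r.
    apply Rplus_le_compat; [|lra].
    eapply Rle_trans; [exact (proj2 (HT q Hq1))|].
    replace (B * Cmod (q - p)%C ^ 2)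
      with (B * Cmod (q - p)%C * Cmod (q - p)%C) by ring.
    apply Rmult_le_compat_r; [exact H0|]. apply Rmult_le_compat_l; lra.
  - apply Rle_lt_trans with (L * (eps / (L + 1))).
    + apply Rmult_le_compat_l; lra.
    + apply Rmult_lt_reg_r with (L + 1); [lra|].
      replace (L * (eps / (L + 1)) * (L + 1)) with (L * eps) by (field; lra).
      lra.
Qed.

(** * Harmonicity of sums of analytic and conjugate analytic functions *)

Lemma open_in_disk (x y : R) : in_disk (x, y) ->
  locally_2d (fun u v => in_disk (u, v)) x y.
Proof.
  unfold in_disk. intros Hp.
  assert (Hd : 0 < (1 - Cmod (x, y)) / 2) by lra.
  exists (mkposreal _ Hd). intros u v Hu Hv. simpl in Hu, Hv.
  assert (H := Cmod_le_Re_Im ((u, v) - (x, y))%C).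
  change (Cmod ((u, v) - (x, y))%C <= Rabs (u - x) + Rabs (v - y)) in H.
  replace (u, v) with ((x, y) + ((u, v) - (x, y)))%C by ring.
  eapply Rle_lt_trans; [apply Cmod_triangle | lra].
Qed.

Lemma power_series_is_derive_x (h h' : C -> C) (a : nat -> C) (c : C)
    (x y : R) :
  power_series_on_disk h a -> power_series_on_disk h' (CPS_derive a) ->
  in_disk (x, y) ->
  is_derive (fun t => Re (c * h (t, y))%C) x (Re (c * h' (x, y))%C).
Proof.
  intros Ha Ha' Hp.
  assert (E : forall t, ((0, y) + RtoC t * 1)%C = (t, y)).
  { intros t. unfold Cplus, Cmult, RtoC; simpl; f_equal; ring. }
  rewrite <- (E x) in *.
  apply is_derive_ext with (fun t => Re (c * h ((0, y) + RtoC t * 1))%C).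
  { intros t; now rewrite E. }
  assert (H := power_series_is_derive_line h h' a Ha Ha' c _ 1 x Hp).
  now rewrite (Cmult_1_r c) in H.
Qed.

Lemma power_series_is_derive_y (h h' : C -> C) (a : nat -> C) (c : C)
    (x y : R) :
  power_series_on_disk h a -> power_series_on_disk h' (CPS_derive a) ->
  in_disk (x, y) ->
  is_derive (fun t => Re (c * h (x, t))%C) y (Re (c * Ci * h' (x, y))%C).
Proof.
  intros Ha Ha' Hp.
  assert (E : forall t, ((x, 0) + RtoC t * Ci)%C = (x, t)).
  { intros t. unfold Cplus, Cmult, RtoC, Ci; simpl; f_equal; ring. }
  rewrite <- (E y) in *.
  apply is_derive_ext with (fun t => Re (c * h ((x, 0) + RtoC t * Ci))%C).
  { intros t; now rewrite E. }
  now apply power_series_is_derive_line with (a := a).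
Qed.

(** The functions Re (c * h), for h a power series and c a constant, form a
    class closed under partial derivatives: the derivatives are Re (c * h')
    and Re (c * i * h').  As its members are continuous, they are smooth. *)
Lemma power_series_ex_diff_n (n : nat) (h : C -> C) (a : nat -> C) (c : C)
    (x y : R) :
  power_series_on_disk h a -> in_disk (x, y) ->
  ex_diff_n (fun u v => Re (c * h (u, v))%C) n x y.
Proof.
  revert h a c. induction n as [|n IH]; intros h a c Ha Hp.
  - split; [|exact I].
    apply power_series_continuity_2d with (CPSeries (CPS_derive a)) a;
      eauto using power_series_derive.
  - assert (Ha' := power_series_derive h a Ha).
    set (h' := CPSeries (CPS_derive a)) in *.
    assert (Hx := fun u v => power_series_is_derive_x h h' a c u v Ha Ha').
    assert (Hy := fun u v => power_series_is_derive_y h h' a c u v Ha Ha').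
    split; [|split; [|split; [|split]]].
    + now apply power_series_continuity_2d with h' a.
    + eexists; apply Hx; exact Hp.
    + eexists; apply Hy; exact Hp.
    + apply ex_diff_n_ext_loc with (2 := IH h' (CPS_derive a) c Ha' Hp).
      generalize (open_in_disk x y Hp). apply locally_2d_impl, locally_2d_forall.
      intros u v Huv. symmetry. apply is_derive_unique, Hx, Huv.
    + apply ex_diff_n_ext_loc with (2 := IH h' (CPS_derive a) (c * Ci)%C Ha' Hp).
      generalize (open_in_disk x y Hp). apply locally_2d_impl, locally_2d_forall.
      intros u v Huv. symmetry. apply is_derive_unique, Hy, Huv.
Qed.

(** Differentiating twice in the direction i multiplies by i^2 = -1. *)
Lemma power_series_real_harmonic (h : C -> C) (a : nat -> C) (c : C) :
  power_series_on_disk h a ->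
  real_harmonic_on_disk (fun x y => Re (c * h (x, y))%C).
Proof.
  intros Ha x y Hp. split; [now apply power_series_ex_diff_n with a|].
  assert (Ha' := power_series_derive h a Ha).
  set (h' := CPSeries (CPS_derive a)) in *.
  assert (Ha'' := power_series_derive h' _ Ha').
  set (h'' := CPSeries (CPS_derive (CPS_derive a))) in *.
  assert (Ho := open_in_disk x y Hp).
  assert (Exx : partial_derive 2 0 (fun x y => Re (c * h (x, y))%C) x y
                = Re (c * h'' (x, y))%C).
  { apply is_derive_unique.
    apply is_derive_ext_loc with (fun t => Re (c * h' (t, y))%C).
    - generalize (locally_2d_1d_const_y _ x y Ho). apply filter_imp.
      intros t Ht. symmetry. apply is_derive_unique.
      now apply power_series_is_derive_x with a.
    - now apply power_series_is_derive_x with (CPS_derive a). }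
  assert (Eyy : partial_derive 0 2 (fun x y => Re (c * h (x, y))%C) x y
                = Re (c * Ci * Ci * h'' (x, y))%C).
  { apply is_derive_unique.
    apply is_derive_ext_loc with (fun t => Re (c * Ci * h' (x, t))%C).
    - generalize (locally_2d_1d_const_x _ x y Ho). apply filter_imp.
      intros t Ht. symmetry. apply is_derive_unique.
      now apply power_series_is_derive_y with a.
    - now apply power_series_is_derive_y with (CPS_derive a). }
  rewrite Exx, Eyy. unfold Re, Cmult, Ci; simpl. ring.
Qed.

Lemma real_harmonic_ext (u v : R -> R -> R) :
  (forall x y, in_disk (x, y) -> u x y = v x y) ->
  real_harmonic_on_disk u -> real_harmonic_on_disk v.
Proof.
  intros E Hu x y Hp. destruct (Hu x y Hp) as [Hn Hl].
  assert (Ho := open_in_disk x y Hp).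
  assert (Hloc : locally_2d (fun x y => u x y = v x y) x y).
  { generalize Ho. apply locally_2d_impl, locally_2d_forall. exact E. }
  split; [now apply ex_diff_n_ext_loc with u|].
  now rewrite <- !(partial_derive_ext_loc u v _ _ x y Hloc).
Qed.

(** Re f is the real part of h + g, and Im f is the real part of
    - i * (h - g). *)
Lemma canonical_representation_harmonic (f h g : C -> C) (a b : nat -> C) :
  canonical_representation f h g a b -> harmonic_mapping f.
Proof.
  intros (Hf & _ & Ha & _ & Hb & _). split.
  - apply real_harmonic_ext
      with (fun x y => Re (1 * (1 * h (x, y) + 1 * g (x, y)))%C).
    + intros x y Hp. rewrite Hf by exact Hp.
      unfold Re, Cmult, Cplus, Cconj, RtoC; simpl; ring.
    + exact (power_series_real_harmonic _ _ 1%C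
               (power_series_lincomb h g a b 1%C 1%C Ha Hb)).
  - apply real_harmonic_ext
      with (fun x y => Re (- Ci * (1 * h (x, y) + (- (1)) * g (x, y)))%C).
    + intros x y Hp. rewrite Hf by exact Hp.
      unfold Re, Im, Ci, Copp, Cmult, Cplus, Cconj, RtoC; simpl; ring.
    + exact (power_series_real_harmonic _ _ (- Ci)%C
               (power_series_lincomb h g a b 1%C (- (1))%C Ha Hb)).
Qed.

(** * Integrals of trigonometric products *)

Definition expi (t : R) : C := (cos t, sin t).

Lemma expi_plus (s t : R) : expi (s + t) = (expi s * expi t)%C.
Proof.
  unfold expi, Cmult; simpl. rewrite cos_plus, sin_plus. f_equal; ring.
Qed.

Lemma expi_pow (t : R) (k : nat) : (expi t ^ k)%C = expi (INR k * t).
Proof.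
  induction k as [|k IH].
  - simpl. rewrite Rmult_0_l. unfold expi. now rewrite cos_0, sin_0.
  - rewrite Cpow_S, IH, <- expi_plus, S_INR. f_equal; ring.
Qed.

Lemma Cmod_expi (t : R) : Cmod (expi t) = 1.
Proof.
  unfold Cmod, expi; simpl.
  replace (_ + _) with 1; [apply sqrt_1|].
  generalize (sin2_cos2 t); unfold Rsqr; lra.
Qed.

Lemma polar_form (z : C) : exists t, z = (RtoC (Cmod z) * expi t)%C.
Proof.
  destruct (Ceq_dec z 0) as [->|Hz].
  { exists 0. rewrite Cmod_0. ring. }
  apply Cmod_gt_0 in Hz.
  assert (Hm := Cmod2_alt z).
  set (m := Cmod z) in *.
  set (x := Re z / m). set (y := Im z / m).
  assert (Hxy : x * x + y * y = 1).
  { unfold x, y. apply Rmult_eq_reg_r with (m ^ 2).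
    - rewrite Hm at 2. field. lra.
    - apply pow_nonzero; lra. }
  assert (Hx : -1 <= x <= 1) by nra.
  assert (Hcos := cos_acos x Hx). assert (Hsin := sin_acos x Hx).
  replace (1 - x²) with (y²) in Hsin by (unfold Rsqr; lra).
  rewrite sqrt_Rsqr_abs in Hsin.
  assert (Hz' : z = (RtoC m * (x, y))%C).
  { unfold x, y, Cmult, RtoC; simpl. destruct z as [p q]; simpl.
    f_equal; field; lra. }
  destruct (Rle_dec 0 y) as [Hy|Hy].
  - exists (acos x). rewrite Hz' at 1. unfold expi.
    rewrite Hcos, Hsin, Rabs_pos_eq by lra. reflexivity.
  - exists (- acos x). rewrite Hz' at 1. unfold expi.
    rewrite cos_neg, sin_neg, Hcos, Hsin, Rabs_left by lra.
    now rewrite Ropp_involutive.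
Qed.

Lemma is_RInt_antiderivative (F f : R -> R) (a b : R) :
  (forall t, is_derive F t (f t)) -> (forall t, ex_derive f t) ->
  is_RInt f a b (F b - F a).
Proof.
  intros HF Hf.
  apply (is_RInt_derive (V := R_CompleteNormedModule) F f).
  - intros t _; apply HF.
  - intros t _; apply (@ex_derive_continuous R_AbsRing R_NormedModule), Hf.
Qed.

Lemma is_RInt_cos_mult_neq (k n : nat) (phi theta t0 : R) :
  k <> n -> (1 <= n)%nat ->
  is_RInt (fun t => cos (INR k * t + phi) * cos (INR n * t + theta))
          t0 (t0 + 2 * PI) 0.
Proof.
  intros Hkn Hn.
  assert (H1 : INR k + INR n <> 0) by (rewrite <- plus_INR; apply not_0_INR; lia).
  assert (H2 : INR k - INR n <> 0) by (apply Rminus_eq_contra, not_INR, Hkn).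
  set (F := fun t =>
     / 2 * (sin ((INR k + INR n) * t + (phi + theta)) / (INR k + INR n)
            + sin ((INR k - INR n) * t + (phi - theta)) / (INR k - INR n))).
  replace 0 with (F (t0 + 2 * PI) - F t0).
  - apply is_RInt_antiderivative.
    + intros t. unfold F. auto_derive; [exact I|].
      match goal with |- ?l = _ => replace l with
        (/ 2 * (cos ((INR k + INR n) * t + (phi + theta))
                + cos ((INR k - INR n) * t + (phi - theta)))) by (field; now split) end.
      rewrite form1.
      replace ((_ - _) / 2) with (INR n * t + theta) by field.
      replace ((_ + _) / 2) with (INR k * t + phi) by field.
      field.
    + intros t. auto_derive. exact I.
  - unfold F.
    replace ((INR k + INR n) * (t0 + 2 * PI) + (phi + theta))
      with ((INR k + INR n) * t0 + (phi + theta) + 2 * INR (k + n) * PI)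
      by (rewrite plus_INR; ring).
    rewrite sin_period.
    replace (sin ((INR k - INR n) * (t0 + 2 * PI) + (phi - theta)))
      with (sin ((INR k - INR n) * t0 + (phi - theta))).
    { ring. }
    (* periodicity is available for natural multiples of 2 PI only, so the sign
       of k - n decides which side is shifted *)
    destruct (Nat.le_gt_cases k n) as [Hle|Hlt].
    + rewrite <- (sin_period ((INR k - INR n) * (t0 + 2 * PI) + (phi - theta))
                  (n - k)).
      f_equal. rewrite minus_INR by exact Hle. ring.
    + rewrite <- (sin_period ((INR k - INR n) * t0 + (phi - theta)) (k - n)).
      f_equal. rewrite minus_INR by lia. ring.
Qed.

Lemma is_RInt_cos_sqr (n : nat) (theta t0 : R) : (1 <= n)%nat ->
  is_RInt (fun t => cos (INR n * t + theta) * cos (INR n * t + theta))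
          t0 (t0 + 2 * PI) PI.
Proof.
  intros Hn.
  assert (H1 : INR n <> 0) by (apply not_0_INR; lia).
  set (F := fun t =>
     / 2 * (t + sin (2 * (INR n * t + theta)) / (2 * INR n))).
  replace PI with (F (t0 + 2 * PI) - F t0) at 2.
  - apply is_RInt_antiderivative.
    + intros t. unfold F. auto_derive; [exact I|].
      rewrite cos_2a_cos. field. exact H1.
    + intros t. auto_derive. exact I.
  - unfold F.
    replace (2 * (INR n * (t0 + 2 * PI) + theta))
      with (2 * (INR n * t0 + theta) + 2 * INR (2 * n) * PI)
      by (rewrite mult_INR; simpl; ring).
    rewrite sin_period. field. exact H1.
Qed.

(** The first half-wave has area 2; the others are a translate by PI of one
    half-wave less, since |cos| has period PI. *)
Lemma is_RInt_Rabs_cos (m : nat) :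
  is_RInt (fun s => Rabs (cos s)) (- (PI / 2)) (- (PI / 2) + INR m * PI)
          (2 * INR m).
Proof.
  assert (Hpi := PI_RGT_0).
  induction m as [|m IH].
  - simpl. rewrite Rmult_0_l, Rplus_0_r, Rmult_0_r. apply (is_RInt_point (V := R_NormedModule)).
  - replace (2 * INR (S m)) with (2 + 2 * INR m) by (rewrite S_INR; ring).
    apply (is_RInt_Chasles (V := R_NormedModule)) with (PI / 2).
    + apply is_RInt_ext with cos.
      { intros s. rewrite Rmin_left, Rmax_right by lra. intros Hs.
        symmetry. apply Rabs_pos_eq, cos_ge_0; lra. }
      replace 2 with (sin (PI / 2) - sin (- (PI / 2))) at 3
        by (rewrite sin_neg, sin_PI2; ring).
      apply is_RInt_antiderivative; intros s; auto_derive; trivial; ring.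
    + apply is_RInt_ext with (fun s => scal 1 (Rabs (cos (1 * s + - PI)))).
      { intros s _. unfold scal; simpl; unfold mult; simpl.
        rewrite Rmult_1_l.
        replace (cos s) with (- cos (1 * s + - PI)).
        - symmetry; apply Rabs_Ropp.
        - rewrite <- neg_cos. f_equal; ring. }
      apply (is_RInt_comp_lin (V := R_NormedModule) (fun s => Rabs (cos s))).
      replace (1 * (PI / 2) + - PI) with (- (PI / 2)) by field.
      replace (1 * _ + - PI) with (- (PI / 2) + INR m * PI)
        by (rewrite S_INR; field).
      exact IH.
Qed.

(** The starting point t0 is the zero of cos (n t + theta) that the
    substitution s = n t + theta sends to - PI / 2; the period then becomes
    2 n half-waves of area 2. *)
Lemma is_RInt_Rabs_cos_mult (n : nat) (theta : R) : (1 <= n)%nat ->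
  exists t0, is_RInt (fun t => Rabs (cos (INR n * t + theta)))
               t0 (t0 + 2 * PI) 4.
Proof.
  intros Hn.
  assert (H1 : INR n <> 0) by (apply not_0_INR; lia).
  exists ((- (PI / 2) - theta) / INR n).
  set (t0 := (- (PI / 2) - theta) / INR n).
  apply is_RInt_ext with
    (fun t => scal (/ INR n) (scal (INR n) (Rabs (cos (INR n * t + theta))))).
  { intros t _. unfold scal; simpl; unfold mult; simpl. field. exact H1. }
  replace 4 with (/ INR n * (2 * INR (2 * n)))
    by (rewrite mult_INR; simpl; field; exact H1).
  apply (is_RInt_scal (V := R_NormedModule) (fun t => scal (INR n) (Rabs (cos (INR n * t + theta))))).
  apply (is_RInt_comp_lin (V := R_NormedModule) (fun s => Rabs (cos s))).
  replace (INR n * t0 + theta) with (- (PI / 2)) by (unfold t0; field; exact H1).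
  replace (INR n * (t0 + 2 * PI) + theta) with (- (PI / 2) + INR (2 * n) * PI)
    by (unfold t0; rewrite mult_INR; simpl; field; exact H1).
  apply is_RInt_Rabs_cos.
Qed.

(** * The coefficient bound *)

(** Orthogonality: after writing each coefficient in polar form, the k-th term
    is a multiple of cos (k t + phi), which only correlates with the kernel
    when k = n; there phi = theta by the choice of theta. *)
Lemma is_RInt_partial_sum_cos (c : nat -> C) (r theta t0 : R) (n K : nat) :
  (1 <= n)%nat -> c n = (RtoC (Cmod (c n)) * expi theta)%C -> 0 <= r ->
  is_RInt (fun t => sum_n (fun k => Re (c k * (RtoC r * expi t) ^ k)%C) K
                    * cos (INR n * t + theta))
          t0 (t0 + 2 * PI)
          (if (n <=? K)%nat then PI * (Cmod (c n) * r ^ n) else 0).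
Proof.
  intros Hn Hc Hr.
  assert (Hterm : forall k, is_RInt
    (fun t => Re (c k * (RtoC r * expi t) ^ k)%C * cos (INR n * t + theta))
    t0 (t0 + 2 * PI) (if (k =? n)%nat then PI * (Cmod (c n) * r ^ n) else 0)).
  { intros k.
    assert (Hk : exists phi, c k = (RtoC (Cmod (c k)) * expi phi)%C
                             /\ (k = n -> phi = theta)).
    { destruct (Nat.eq_dec k n) as [->|Hkn].
      - now exists theta.
      - destruct (polar_form (c k)) as [phi Hphi]. now exists phi. }
    destruct Hk as (phi & Hphi & Hkn).
    apply is_RInt_ext with (fun t => scal (Cmod (c k) * r ^ k)
       (cos (INR k * t + phi) * cos (INR n * t + theta))).
    { intros t _. rewrite Hphi at 2.
      rewrite Cpow_mult_l, expi_pow, <- RtoC_pow.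
      replace (_ * _ * _)%C
        with (RtoC (Cmod (c k) * r ^ k) * expi (INR k * t + phi))%C
        by (rewrite expi_plus, RtoC_mult; ring).
      unfold scal, Re, Cmult, expi, RtoC; simpl. unfold mult; simpl. ring. }
    replace (if (k =? n)%nat then _ else _)
      with (Cmod (c k) * r ^ k * (if (k =? n)%nat then PI else 0)).
    - apply (is_RInt_scal (V := R_NormedModule)
               (fun t => cos (INR k * t + phi) * cos (INR n * t + theta))).
      destruct (Nat.eqb_spec k n) as [->|Hneq].
      + rewrite Hkn by reflexivity. now apply is_RInt_cos_sqr.
      + now apply is_RInt_cos_mult_neq.
    - destruct (Nat.eqb_spec k n) as [->|Hneq]; ring. }
  induction K as [|K IH].
  - apply is_RInt_ext with
      (fun t => Re (c 0%nat * (RtoC r * expi t) ^ 0)%C * cos (INR n * t + theta)).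
    { intros t _. now rewrite sum_O. }
    destruct n as [|n]; [lia|]. exact (Hterm 0%nat).
  - apply is_RInt_ext with (fun t =>
      plus (sum_n (fun k => Re (c k * (RtoC r * expi t) ^ k)%C) K
                    * cos (INR n * t + theta))
           (Re (c (S K) * (RtoC r * expi t) ^ S K)%C * cos (INR n * t + theta))).
    { intros t _. rewrite sum_Sn. unfold plus; simpl. ring. }
    replace (if (n <=? S K)%nat then _ else _) with
      ((if (n <=? K)%nat then PI * (Cmod (c n) * r ^ n) else 0)
       + (if (S K =? n)%nat then PI * (Cmod (c n) * r ^ n) else 0)).
    + exact (is_RInt_plus (V := R_NormedModule) _ _ _ _ _ _ IH (Hterm (S K))).
    + destruct (Nat.leb_spec n K), (Nat.leb_spec n (S K)),
        (Nat.eqb_spec (S K) n); try lia; ring.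
Qed.

Lemma is_series_tail_le (u v : nat -> R) (l L : R) (K : nat) :
  (forall k, Rabs (u k) <= v k) -> is_series u l -> is_series v L ->
  Rabs (l - sum_n u K) <= L - sum_n v K.
Proof.
  intros Huv Hu Hv.
  refine (is_series_norm_le (V := R_NormedModule) (fun k => u (S K + k)%nat)
            (fun k => v (S K + k)%nat) _ _ _ _ _).
  - intros k. apply Huv.
  - apply is_series_incr_n; [lia|]. simpl pred.
    replace (plus _ _) with l; [exact Hu|].
    unfold plus; simpl. change (@eq R l (l - sum_n u K + sum_n u K)). ring.
  - apply is_series_incr_n; [lia|]. simpl pred.
    replace (plus _ _) with L; [exact Hv|].
    unfold plus; simpl. change (@eq R L (L - sum_n v K + sum_n v K)). ring.
Qed.

(** The error is at most the tail of the absolute series at r, which does not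
    depend on the point of the circle. *)
Lemma power_series_uniform_on_circle (H : C -> C) (c : nat -> C) (r eps : R) :
  power_series_on_disk H c -> 0 <= r < 1 -> 0 < eps ->
  exists K0, forall K z, (K0 <= K)%nat -> Cmod z = r ->
    Rabs (Re (H z) - sum_n (fun k => Re (c k * z ^ k)%C) K) <= eps.
Proof.
  intros Hc Hr Heps.
  assert (HA : exists L : R, is_series (fun k => Cmod (c k) * r ^ k) L).
  { apply (ex_series_abs_coef c r); [|exact Hr].
    exact (power_series_CV_radius H c Hc). }
  destruct HA as [L HL].
  destruct (proj1 (filterlim_locally _ _) HL (mkposreal eps Heps)) as [K0 HK].
  exists K0. intros K z HK0 Hz.
  assert (Hd : in_disk z) by (unfold in_disk; lra).
  assert (Hs := is_cseries_re _ _ (proj1 (is_pseries_C _ _ _) (Hc z Hd))).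
  eapply Rle_trans.
  { apply is_series_tail_le with (2 := Hs) (3 := HL). intros k.
    eapply Rle_trans; [apply re_le_Cmod|].
    rewrite Cmod_mult, Cmod_pow, Hz. apply Rle_refl. }
  specialize (HK K HK0).
  change (Rabs (sum_n (fun k => Cmod (c k) * r ^ k) K - L) < eps) in HK.
  apply Rabs_def2 in HK. lra.
Qed.

Lemma pow_ge_Bernoulli (r : R) (n : nat) :
  0 <= r <= 1 -> 1 - INR n * (1 - r) <= r ^ n.
Proof.
  intros Hr. induction n as [|n IH]; [simpl; lra|].
  rewrite S_INR. simpl.
  assert (Hp : r ^ n <= 1) by (rewrite <- (pow1 n); apply pow_incr; lra).
  nra.
Qed.

(** The classical coefficient bound for analytic maps into a vertical strip.
    Testing Re H against cos (n t + theta), with theta the argument of c n,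
    picks out r^n |c n|; the constant is the L1 norm 4 of the kernel divided
    by PI. *)
Theorem bounded_re_coef_le (H : C -> C) (c : nat -> C) (M : R) (n : nat) :
  power_series_on_disk H c ->
  (forall z, in_disk z -> Rabs (Re (H z)) <= M) ->
  (1 <= n)%nat ->
  Cmod (c n) <= 4 / PI * M.
Proof.
  intros Hc HM Hn.
  assert (Hpi := PI_RGT_0). assert (H0 := Cmod_ge_0 (c n)).
  destruct (polar_form (c n)) as [theta Htheta].
  destruct (is_RInt_Rabs_cos_mult n theta Hn) as [t0 HI].
  assert (Hcircle : forall r, 0 <= r < 1 ->
            PI * (Cmod (c n) * r ^ n) <= 4 * M).
  { intros r Hr. apply le_epsilon. intros e He.
    destruct (power_series_uniform_on_circle H c r (e / 4) Hc Hr) as [K0 HK];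
      [lra|].
    set (K := Nat.max K0 n).
    assert (HS := is_RInt_partial_sum_cos c r theta t0 n K Hn Htheta (proj1 Hr)).
    replace (n <=? K)%nat with true in HS
      by (symmetry; apply Nat.leb_le; lia).
    assert (HI' := is_RInt_scal (V := R_NormedModule) _ _ _ (M + e / 4) _ HI).
    replace (4 * M + e) with ((M + e / 4) * 4) by field.
    refine (is_RInt_le _ _ _ _ _ _ _ HS HI' _); [lra|].
    intros t _. unfold scal; simpl; unfold mult; simpl.
    assert (Hz : Cmod (RtoC r * expi t)%C = r).
    { rewrite Cmod_mult, Cmod_expi, Cmod_R, Rabs_pos_eq; lra. }
    assert (Hd : in_disk (RtoC r * expi t)%C) by (unfold in_disk; lra).
    assert (B1 := HK K _ (Nat.le_max_l _ _) Hz). assert (B2 := HM _ Hd).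
    set (S := sum_n _ K) in *.
    assert (B3 : Rabs S <= M + e / 4).
    { replace S with (Re (H (RtoC r * expi t)%C)
                      - (Re (H (RtoC r * expi t)%C) - S)) by ring.
      eapply Rle_trans; [apply Rabs_triang|]. rewrite Rabs_Ropp. lra. }
    eapply Rle_trans; [apply Rle_abs|]. rewrite Rabs_mult.
    apply Rmult_le_compat_r; [apply Rabs_pos | exact B3]. }
  apply Rmult_le_reg_l with PI; [exact Hpi|].
  replace (PI * (4 / PI * M)) with (4 * M) by (field; lra).
  apply le_epsilon. intros e He.
  (* let r = 1 - eta tend to 1; by Bernoulli the loss in r^n is at most
     n * eta, and [eta] is small enough for D * eta <= e *)
  set (D := PI * Cmod (c n) * INR n).
  assert (HD : 0 <= D).
  { apply Rmult_le_pos; [|apply pos_INR]. apply Rmult_le_pos; lra. }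
  set (eta := Rmin 1 (e / (D + 1))).
  assert (Heta : 0 < eta <= 1).
  { split; [|apply Rmin_l]. apply Rmin_glb_lt; [lra|].
    apply Rdiv_lt_0_compat; lra. }
  assert (HDe : D * eta <= e).
  { apply Rle_trans with ((D + 1) * (e / (D + 1))).
    - apply Rmult_le_compat; [lra|lra|lra|apply Rmin_r].
    - apply Req_le. field. lra. }
  assert (B1 := Hcircle (1 - eta) ltac:(lra)).
  assert (B2 := pow_ge_Bernoulli (1 - eta) n ltac:(lra)).
  assert (B3 : PI * Cmod (c n) * (1 - INR n * (1 - (1 - eta)))
               <= PI * Cmod (c n) * (1 - eta) ^ n).
  { apply Rmult_le_compat_l; [|exact B2]. apply Rmult_le_pos; lra. }
  unfold D in HDe. lra.
Qed.

(** Two rotations in opposite directions align a n and b n: multiplying f by u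
    multiplies the analytic part by u and the conjugated part by conj u. *)
Theorem harmonic_coef_sum_le (f h g : C -> C) (a b : nat -> C) (M : R) (n : nat) :
  canonical_representation f h g a b ->
  (forall z, in_disk z -> Cmod (f z) <= M) -> (1 <= n)%nat ->
  Cmod (a n) + Cmod (b n) <= 4 / PI * M.
Proof.
  intros (Hf & _ & Ha & _ & Hb & _) HM Hn.
  destruct (polar_form (a n)) as [alpha Halpha].
  destruct (polar_form (b n)) as [beta Hbeta].
  set (u := expi ((beta - alpha) / 2)).
  assert (Hu : Cmod u = 1) by apply Cmod_expi.
  assert (Hconj : Cconj u = expi ((alpha - beta) / 2)).
  { unfold u, expi, Cconj; simpl.
    replace ((alpha - beta) / 2) with (- ((beta - alpha) / 2)) by field.
    now rewrite cos_neg, sin_neg. }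
  assert (E : Cmod (u * a n + Cconj u * b n)%C = Cmod (a n) + Cmod (b n)).
  { replace (u * a n + Cconj u * b n)%C
      with (RtoC (Cmod (a n) + Cmod (b n)) * expi ((alpha + beta) / 2))%C.
    - rewrite Cmod_mult, Cmod_expi, Cmod_R, Rabs_pos_eq; [ring|].
      apply Rplus_le_le_0_compat; apply Cmod_ge_0.
    - rewrite Halpha at 2. rewrite Hbeta at 2.
      transitivity (RtoC (Cmod (a n)) * (u * expi alpha)
                    + RtoC (Cmod (b n)) * (Cconj u * expi beta))%C; [|ring].
      rewrite Hconj. unfold u. rewrite <- !expi_plus.
      replace ((beta - alpha) / 2 + alpha) with ((alpha + beta) / 2) by field.
      replace ((alpha - beta) / 2 + beta) with ((alpha + beta) / 2) by field.
      rewrite RtoC_plus. ring. }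
  rewrite <- E.
  refine (bounded_re_coef_le (fun z => u * h z + Cconj u * g z)%C
    (fun k => u * a k + Cconj u * b k)%C M n _ _ Hn).
  - now apply power_series_lincomb.
  - intros z Hz.
    replace (Re (u * h z + Cconj u * g z)%C) with (Re (u * f z)%C).
    + eapply Rle_trans; [apply re_le_Cmod|].
      rewrite Cmod_mult, Hu, Rmult_1_l. now apply HM.
    + rewrite Hf by exact Hz. unfold Re, Cmult, Cplus, Cconj; simpl. ring.
Qed.

(** * The power series of the inverse hyperbolic tangent *)

Lemma Cgeom (z : C) : in_disk z -> (1 - z)%C <> 0 /\
  is_cseries (fun k => z ^ k)%C (/ (1 - z))%C.
Proof.
  intros Hz. unfold in_disk in Hz.
  assert (Hnz : (1 - z)%C <> 0).
  { intros E. replace z with (1 - (1 - z))%C in Hz by ring.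
    rewrite E in Hz. replace (1 - 0)%C with (RtoC 1) in Hz by ring.
    rewrite Cmod_1 in Hz. lra. }
  split; [exact Hnz|].
  assert (HS : is_cseries (fun k => z ^ k)%C (CSeries (fun k => z ^ k)%C)).
  { apply CSeries_correct with (fun k => Cmod z ^ k).
    - intros k. rewrite Cmod_pow. lra.
    - apply ex_series_geom. rewrite Rabs_pos_eq by apply Cmod_ge_0. exact Hz. }
  set (L := CSeries (fun k => z ^ k)%C) in *.
  (* removing the first term and multiplying by z have the same effect, so
     that L - 1 = z * L *)
  assert (H1 : is_cseries (fun k => z ^ S k)%C (L - 1)%C).
  { apply (is_series_incr_1 (fun k => z ^ k)%C).
    replace (plus _ _) with L; [exact HS|].
    change (@eq C L (L - 1 + 1)%C). ring. }
  assert (H2 := is_series_scal_l z _ _ HS).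
  assert (E : (L - 1)%C = (z * L)%C).
  { rewrite <- (CSeries_unique _ _ H1). exact (CSeries_unique _ _ H2). }
  assert (E2 : ((1 - z) * L)%C = 1).
  { replace ((1 - z) * L)%C with (L - z * L)%C by ring. rewrite <- E. ring. }
  replace (/ (1 - z))%C with (/ (1 - z) * ((1 - z) * L))%C
    by (rewrite E2; ring).
  now rewrite Cmult_assoc, Cinv_l, Cmult_1_l.
Qed.

(** The geometric series enters the derivative of artanh through
    1 / (1 - z^2) = (1 / (1 - z) + 1 / (1 + z)) / 2. *)
Lemma Cgeom_power_series :
  power_series_on_disk (fun z => / (1 - z))%C (fun _ => RtoC 1).
Proof.
  intros z Hz. apply is_pseries_C.
  apply is_series_ext with (2 := proj2 (Cgeom z Hz)).
  intros k. change (@eq C (z ^ k) (1 * z ^ k))%C. ring.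
Qed.

Lemma Cgeom_alt_power_series :
  power_series_on_disk (fun z => / (1 + z))%C (fun k => RtoC ((-1) ^ k)).
Proof.
  intros z Hz. apply is_pseries_C.
  assert (Hz' : in_disk (- z)%C) by (unfold in_disk; now rewrite Cmod_opp).
  replace (1 + z)%C with (1 - - z)%C by ring.
  apply is_series_ext with (2 := proj2 (Cgeom _ Hz')).
  intros k. change (@eq C ((- z) ^ k) (RtoC ((-1) ^ k) * z ^ k))%C.
  replace (- z)%C with (RtoC (-1) * z)%C by ring.
  now rewrite Cpow_mult_l, RtoC_pow.
Qed.

(** Equal to 1 / k for odd k and to 0 for even k; at k = 0 the numerator
    vanishes, so the division by zero is harmless. *)
Definition artanh_coef (k : nat) : C := RtoC ((1 - (-1) ^ k) / 2 / INR k).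

(** This is 1 / (1 - z^2); the decomposition into partial fractions matches
    the two geometric series. *)
Definition artanh_derive (z : C) : C := (/ 2 * / (1 - z) + / 2 * / (1 + z))%C.

Lemma artanh_derive_power_series :
  power_series_on_disk artanh_derive (CPS_derive artanh_coef).
Proof.
  intros z Hz. apply is_pseries_C.
  assert (H := proj1 (is_pseries_C _ _ _)
    (power_series_lincomb _ _ _ _ (/ 2)%C (/ 2)%C
       Cgeom_power_series Cgeom_alt_power_series z Hz)).
  apply is_series_ext with (2 := H). intros k.
  unfold CPS_derive, artanh_coef.
  change (@eq C ((/ 2 * 1 + / 2 * RtoC ((-1) ^ k)) * z ^ k)
     (RtoC (INR (S k)) * RtoC ((1 - (-1) ^ S k) / 2 / INR (S k)) * z ^ k))%C.
  f_equal. rewrite <- RtoC_mult.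
  replace (INR (S k) * ((1 - (-1) ^ S k) / 2 / INR (S k)))
    with (/ 2 * 1 + / 2 * (-1) ^ k)
    by (simpl pow; field; apply not_0_INR; lia).
  rewrite RtoC_plus, !RtoC_mult, RtoC_inv by lra. reflexivity.
Qed.

Definition artanh : C -> C := CPSeries artanh_coef.

(** The radius of convergence is read off from the derived series, whose sum
    is known. *)
Lemma artanh_power_series : power_series_on_disk artanh artanh_coef.
Proof.
  apply CPSeries_correct.
  rewrite <- CV_radius_derive.
  rewrite <- (CV_radius_ext _ _ (Cmod_CPS_derive artanh_coef)).
  exact (power_series_CV_radius _ _ artanh_derive_power_series).
Qed.

(** Both sides vanish at 0 and have the same derivative along the segment
    t |-> t * w, namely Im (w / (1 - t^2 w^2)).  On the right-hand side this
    uses (1 - t^2 |w|^2)^2 + 4 t^2 (Im w)^2 = |1 - t w|^2 |1 + t w|^2. *)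
Lemma Im_artanh (w : C) : in_disk w ->
  Im (artanh w) = / 2 * atan (2 * Im w / (1 - Cmod w ^ 2)).
Proof.
  intros Hw. unfold in_disk in Hw. assert (Hw0 := Cmod_ge_0 w).
  set (p := Re w). set (s := Im w). set (q := Cmod w ^ 2).
  assert (Hq : q = p ^ 2 + s ^ 2) by apply Cmod2_alt.
  assert (Hq1 : 0 <= q < 1) by (unfold q; nra).
  (* Re (- i * W) is Im W *)
  set (psi := fun t => Re (- Ci * artanh (0 + RtoC t * w))%C
                       - / 2 * atan (2 * (t * s) / (1 - t ^ 2 * q))).
  assert (Hpsi : psi 0 = psi 1).
  { apply (eq_is_derive (V := R_NormedModule)); [|lra].
    intros t Ht.
    assert (Ht2 : 0 <= t ^ 2 <= 1) by (simpl; nra).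
    assert (Hden : 0 < 1 - t ^ 2 * q) by nra.
    assert (Hin : in_disk (0 + RtoC t * w)%C).
    { unfold in_disk. rewrite Cplus_0_l, Cmod_mult, Cmod_R, Rabs_pos_eq; nra. }
    assert (D1 := power_series_is_derive_line _ _ _ artanh_power_series
                    artanh_derive_power_series (- Ci)%C 0 w t Hin).
    assert (D2 : is_derive (fun t => / 2 * atan (2 * (t * s) / (1 - t ^ 2 * q))) t
       (s * (1 + t ^ 2 * q) / ((1 - t ^ 2 * q) ^ 2 + 4 * t ^ 2 * s ^ 2))).
    { assert (Hden' : 1 + - (t * (t * 1) * q) <> 0)
        by (apply Rgt_not_eq; simpl in Hden; lra).
      assert (Hsq := pow2_ge_0 (t * s)).
      auto_derive; [exact Hden'|].
      clearbody q. clear -Hden Hden' Hsq. field.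
      repeat split; try lra; apply Rgt_not_eq; nra. }
    assert (D := is_derive_minus _ _ _ _ _ D1 D2).
    enough (E0 : Re (- Ci * w * artanh_derive (0 + RtoC t * w))%C
      - s * (1 + t ^ 2 * q) / ((1 - t ^ 2 * q) ^ 2 + 4 * t ^ 2 * s ^ 2) = 0).
    { change (@zero R_NormedModule) with 0. rewrite <- E0. exact D. }
    assert (Hp : p ^ 2 < 1) by (assert (Hs := pow2_ge_0 s); lra).
    assert (Hp' : -1 < p < 1) by nra.
    assert (Htp : -1 < t * p < 1) by nra.
    assert (HN1 : 0 < (1 - t * p) ^ 2 + (t * s) ^ 2)
      by (assert (Hs := pow2_ge_0 (t * s)); nra).
    assert (HN2 : 0 < (1 + t * p) ^ 2 + (t * s) ^ 2)
      by (assert (Hs := pow2_ge_0 (t * s)); nra).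
    assert (HN : (1 - t ^ 2 * q) ^ 2 + 4 * t ^ 2 * s ^ 2
         = ((1 - t * p) ^ 2 + (t * s) ^ 2) * ((1 + t * p) ^ 2 + (t * s) ^ 2))
      by (rewrite Hq; ring).
    apply Rminus_diag_eq. rewrite HN.
    replace w with (p, s) by (symmetry; apply surjective_pairing).
    unfold artanh_derive, Re, Ci, RtoC, Cinv, Cmult, Cplus, Cminus, Copp; simpl.
    rewrite Hq. clear -HN1 HN2. field.
    repeat split; apply Rgt_not_eq; lra. }
  assert (E0 : psi 0 = 0).
  { unfold psi. replace (0 + RtoC 0 * w)%C with (RtoC 0) by ring.
    rewrite (power_series_at_0 _ _ artanh_power_series).
    replace (2 * (0 * s) / (1 - 0 ^ 2 * q)) with 0 by (field; simpl; lra).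
    rewrite atan_0. unfold artanh_coef, Re, Cmult, Copp, Ci, RtoC; simpl.
    unfold Rdiv. ring. }
  assert (E1 : psi 1 = Im (artanh w) - / 2 * atan (2 * s / (1 - q))).
  { unfold psi. replace (0 + RtoC 1 * w)%C with w by ring.
    f_equal.
    - unfold Re, Im, Cmult, Copp, Ci; simpl; ring.
    - do 3 f_equal; ring. }
  lra.
Qed.

Lemma Im_artanh_bound (w : C) : in_disk w -> Rabs (Im (artanh w)) <= PI / 4.
Proof.
  intros Hw. rewrite (Im_artanh w Hw).
  destruct (atan_bound (2 * Im w / (1 - Cmod w ^ 2))) as [H1 H2].
  apply Rabs_le. lra.
Qed.

(** * The extremal mappings *)

(** The coefficients of h (z^n) when h has coefficients a. *)
Definition spread (n : nat) (a : nat -> C) (k : nat) : C :=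
  if (k mod n =? 0)%nat then a (k / n)%nat else 0.

Lemma sum_n_spread (n : nat) (a : nat -> C) (z : C) (K : nat) : (1 <= n)%nat ->
  @sum_n C_AbsRing (fun k => spread n a k * z ^ k)%C K
  = @sum_n C_AbsRing (fun k => a k * (z ^ n) ^ k)%C (K / n).
Proof.
  intros Hn. induction K as [|K IH].
  - rewrite Nat.Div0.div_0_l, !sum_O. unfold spread.
    rewrite Nat.Div0.mod_0_l, Nat.Div0.div_0_l. reflexivity.
  - rewrite sum_Sn, IH. unfold spread.
    assert (HK := Nat.div_mod_eq (S K) n).
    destruct (Nat.eqb_spec (S K mod n) 0) as [E|E].
    + destruct (S K / n)%nat as [|m] eqn:Em; [lia|].
      assert (HKn : (K / n)%nat = m)
        by (symmetry; apply Nat.div_unique with (n - 1)%nat; nia).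
      rewrite HKn, sum_Sn. f_equal.
      rewrite <- Cpow_mult_r. do 2 f_equal. lia.
    + assert (HKn : (K / n)%nat = (S K / n)%nat).
      { symmetry. apply Nat.div_unique with (S K mod n - 1)%nat; [|lia].
        assert (Hm := Nat.mod_upper_bound (S K) n). lia. }
      rewrite HKn. rewrite Cmult_0_l. apply (@plus_zero_r C_AbsRing).
Qed.

(** The partial sum of the new series up to K is the partial sum of the old one
    up to K / n. *)
Lemma power_series_spread (n : nat) (h : C -> C) (a : nat -> C) :
  (1 <= n)%nat -> power_series_on_disk h a ->
  power_series_on_disk (fun z => h (z ^ n)%C) (spread n a).
Proof.
  intros Hn Ha z Hz. apply is_pseries_C.
  assert (Hzn : in_disk (z ^ n)%C).
  { unfold in_disk in *. rewrite Cmod_pow. apply pow_lt_1_compat; [|lia].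
    split; [apply Cmod_ge_0 | exact Hz]. }
  assert (H := proj1 (is_pseries_C _ _ _) (Ha _ Hzn)).
  apply filterlim_ext
    with (fun K => @sum_n C_AbsRing (fun k => a k * (z ^ n) ^ k)%C (K / n)).
  { intros K. symmetry. now apply sum_n_spread. }
  refine (filterlim_comp _ _ _ (fun K => K / n)%nat _ _ _ _ _ H).
  intros P [N HN]. exists (n * N)%nat. intros K HK. apply HN.
  apply Nat.div_le_lower_bound; lia.
Qed.

(** With c = - i * 2 M / PI, the mapping
    f = 2 Re (c * artanh (z^n)) = (4 M / PI) Im (artanh (z^n)) has
    h = g = c * artanh (z^n), whose coefficient of z^n is c. *)
Lemma extremal_mapping (M : R) (n : nat) : 0 <= M -> (1 <= n)%nat ->
  exists (f h g : C -> C) (a b : nat -> C),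
    canonical_representation f h g a b /\
    (forall z : C, in_disk z -> Cmod (f z) <= M) /\
    Cmod (a n) + Cmod (b n) = 4 / PI * M.
Proof.
  intros HM Hn. assert (Hpi := PI_RGT_0).
  set (c := (- Ci * RtoC (2 * M / PI))%C).
  set (h := fun z => (c * artanh (z ^ n))%C).
  set (a := fun k => (c * spread n artanh_coef k)%C).
  assert (Ha : power_series_on_disk h a).
  { apply (power_series_scal (fun z => artanh (z ^ n)%C)).
    now apply power_series_spread, artanh_power_series. }
  assert (Hh : analytic_on_disk h).
  { intros z Hz. eexists.
    apply (power_series_is_derive h _ a Ha (power_series_derive h a Ha) z Hz). }
  exists (fun z => h z + Cconj (h z))%C, h, h, a, a.
  split; [|split].
  - repeat split; try assumption. unfold a, spread.
    rewrite Nat.Div0.mod_0_l, Nat.Div0.div_0_l. simpl.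
    replace (artanh_coef 0) with (RtoC 0).
    + ring.
    + unfold artanh_coef. simpl. f_equal. unfold Rdiv. ring.
  - intros z Hz.
    assert (Hzn : in_disk (z ^ n)%C).
    { unfold in_disk in *. rewrite Cmod_pow. apply pow_lt_1_compat; [|lia].
      split; [apply Cmod_ge_0 | exact Hz]. }
    replace (h z + Cconj (h z))%C
      with (RtoC (4 * M / PI * Im (artanh (z ^ n)%C))).
    + rewrite Cmod_R, Rabs_mult.
      rewrite Rabs_pos_eq.
      * apply Rle_trans with (4 * M / PI * (PI / 4)).
        -- apply Rmult_le_compat_l; [|now apply Im_artanh_bound].
           apply Rle_mult_inv_pos; lra.
        -- apply Req_le. field. lra.
      * apply Rle_mult_inv_pos; lra.
    + unfold h, c. set (W := artanh (z ^ n)%C).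
      destruct W as [x y].
      unfold Re, Im, Cconj, Cmult, Cplus, Copp, Ci, RtoC; simpl.
      f_equal; field; lra.
  - assert (E : Cmod (a n) = 2 * M / PI).
    { unfold a, spread. rewrite Nat.Div0.mod_same, Nat.div_same by lia. simpl.
      replace (artanh_coef 1) with (RtoC 1)
        by (unfold artanh_coef; simpl; f_equal; field).
      replace (c * 1)%C with c by ring.
      unfold c. rewrite Cmod_mult, Cmod_opp, Cmod_Ci, Cmod_R, Rabs_pos_eq.
      - ring.
      - apply Rle_mult_inv_pos; lra. }
    rewrite E. field. lra.
Qed.

Theorem lemma2p1 (M : R) (hM : (0 <= M)%R) :
  (forall (f h g : C -> C) (a b : nat -> C),
      harmonic_mapping f ->
      canonical_representation f h g a b ->
      (forall z : C, in_disk z -> (Cmod (f z) <= M)%R) ->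
      forall n : nat, (1 <= n)%nat ->
        (Cmod (a n) + Cmod (b n) <= 4 / PI * M)%R) /\
  (forall n : nat, (1 <= n)%nat ->
      exists (f h g : C -> C) (a b : nat -> C),
        harmonic_mapping f /\
        canonical_representation f h g a b /\
        (forall z : C, in_disk z -> (Cmod (f z) <= M)%R) /\
        (Cmod (a n) + Cmod (b n) = 4 / PI * M)%R).
Proof.
  split.
  - intros f h g a b _ Hcan HM n Hn.
    exact (harmonic_coef_sum_le f h g a b M n Hcan HM Hn).
  - intros n Hn.
    destruct (extremal_mapping M n hM Hn) as (f & h & g & a & b & Hcan & H).
    exists f, h, g, a, b. split; [|now split].
    exact (canonical_representation_harmonic f h g a b Hcan).
Qed.
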